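(* Suppose $S=S(\lambda_1, \dots, \lambda_d)$ is an $n$-vertex spider with $(\lambda_1, \dots, \lambda_d)$ a partition, $\lambda _1 \geq \lambda _2 +\cdots + \lambda _d$, $\lambda_2 \leq \lambda_3 + \dots + \lambda_d$, and $\lambda_2 \geq 2$. Let $n = q(\lambda_2 + 1) + r$ where $0\leq r <\lambda _2 +1$, and $r = qd' + r'$ where $0\leq r' <q$ (with $q,r,d',r'$ nonnegative integers). If $\lambda_2 \geq 3$, or if $\lambda_2 = 2$ and $q \geq 3$, then $S$ is missing a connected partition of type $$(\lambda_2 + d' + 2)^{r'} (\lambda_2 + d' + 1)^{q - r'}.$$
   Context: Given a partition $\lambda=(\lambda_1\ge\cdots\ge\lambda_d>0)$ of $n-1$ with $d\ge 3$ parts, the spider $S(\lambda_1,\ldots,\lambda_d)$ is the $n$-vertex tree consisting of $d$ disjoint paths $P_{\lambda_1},\ldots,P_{\lambda_d}$ (the legs), where $P_k$ denotes the path with $k$ vertices, together with one further vertex (the centre) joined to one end vertex of each path. A connected partition of an $n$-vertex graph $G$ is a partitioning of its vertex set into $\{V_1,\ldots,V_k\}$ such that the subgraph induced by each $V_j$ is connected; its type is the partition of $n$ obtained by sorting the sizes $|V_j|$ in decreasing order. $G$ is missing a connected partition of type $\mu$ if no connected partition of $G$ has type $\mu$. The notation $a^{r'}b^{q-r'}$ denotes the partition with $r'$ parts equal to $a$ and $q-r'$ parts equal to $b$. *)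

(* Defs.v *)
From mathcomp Require Import all_boot.

Set Implicit Arguments.
Unset Strict Implicit.
Unset Printing Implicit Defensive.

Definition is_int_partition (lam : seq nat) : bool :=
  sorted geq lam && (0 \notin lam).

(* [None] is the centre; [Some (Tagged _ j)] with tag [i] is the vertex at
   distance [j.+1] from the centre on the [i]-th leg (legs numbered from 0). *)
Definition spider (lam : seq nat) : finType :=
  option {i : 'I_(size lam) & 'I_(nth 0 lam i)}.

Definition spider_adj (lam : seq nat) : rel (spider lam) := fun u v =>
  match u, v with
  | None, None => false
  | None, Some x | Some x, None => tagged x == 0 :> nat
  | Some x, Some y => (tag x == tag y) &&
      (((tagged x).+1 == tagged y) || ((tagged y).+1 == tagged x))
  end.
Arguments spider_adj lam : clear implicits.

Lemma spider_adj_sym lam : symmetric (spider_adj lam).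
Proof. by move=> [x|] [y|] //=; rewrite eq_sym orbC. Qed.

Lemma spider_adj_irr lam : irreflexive (spider_adj lam).
Proof. by move=> [x|] //=; rewrite eqxx orbb gtn_eqF. Qed.

Lemma card_spider lam : #|spider lam| = (sumn lam).+1.
Proof.
have -> : sumn lam = \sum_(i < size lam) nth 0 lam i.
  by rewrite sumnE (big_nth 0) big_mkord.
rewrite card_option card_tagged sumnE big_map big_enum; congr _.+1.
by apply: eq_bigr => i _; rewrite card_ord.
Qed.

Section ConnectedPartition.

Variables (V : finType) (adj : rel V).

Definition induced_rel (B : {set V}) : rel V :=
  [rel x y | [&& x \in B, y \in B & adj x y]].

Definition induced_connected (B : {set V}) : bool :=
  (B != set0) && [forall x in B, forall y in B, connect (induced_rel B) x y].

Definition connected_partition (P : {set {set V}}) : bool :=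
  partition P [set: V] && [forall B in P, induced_connected B].

Definition partition_type (P : {set {set V}}) : seq nat :=
  sort geq [seq #|B : {set V}| | B <- enum P].

Definition missing_connected_partition (mu : seq nat) : Prop :=
  ~ exists P : {set {set V}}, connected_partition P /\ partition_type P = mu.

End ConnectedPartition.

(* Main.v *)
Require Import Defs.
From mathcomp Require Import all_boot.
From mathcomp Require Import zify.

(** Every part of the given type is larger than [lambda_2], hence larger than
    each leg other than the longest one.  A connected block that meets a leg but
    avoids the centre is confined to that leg ([centreless_block_in_leg]), so all
    the legs but the longest lie in the block of the centre, whose size is thus
    at least [n - lambda_1 = 1 + lambda_2 + (lambda_3 + ... + lambda_d)]
    ([centre_block_large]), which is at least [1 + 2 lambda_2].

    This is too large.  Since [n >= 1 + 2 (lambda_2 + ... + lambda_d)] is at least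
    [1 + 4 lambda_2] and [r <= lambda_2], the product [q (lambda_2 + 1)] is at
    least [3 lambda_2 + 1], which exceeds [2 (lambda_2 + 1)] because
    [lambda_2 >= 2]; so [q >= 3].  Then [3 d' + r' <= r <= lambda_2]: the excess
    [d'] of the smaller parts over [lambda_2 + 1] is at most a third of
    [lambda_2], and no part reaches [2 lambda_2 + 1]
    ([largest_part_le_double]). *)

Definition leg {lam : seq nat} (i : 'I_(size lam)) : {set spider lam} :=
  [set v : spider lam | if v is Some x then tag x == i else false].

Lemma card_leg {lam} (i : 'I_(size lam)) : #|leg i| <= nth 0 lam i.
Proof.
pose f (j : 'I_(nth 0 lam i)) : spider lam :=
  Some (Tagged (fun i : 'I_(size lam) => 'I_(nth 0 lam i)) j).
apply: (@leq_trans #|f @: [set: 'I_(nth 0 lam i)]|).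
  apply/subset_leq_card/subsetP => -[[k j]|]; rewrite inE //= => /eqP ki.
  by subst k; apply/imsetP; exists j; rewrite ?inE.
by rewrite -[leqRHS]card_ord -cardsT leq_imset_card.
Qed.

(** The centre is the only way out of a leg: away from it, adjacent vertices
    have the same tag. *)
Lemma centreless_block_in_leg {lam} {B : {set spider lam}}
    {x : {i : 'I_(size lam) & 'I_(nth 0 lam i)}} :
  induced_connected (spider_adj lam) B -> None \notin B -> Some x \in B ->
  B \subset leg (tag x).
Proof.
move=> /andP[_ /forall_inP conB] ncB xB; apply/subsetP => y yB.
have closed_leg : closed (induced_rel (spider_adj lam) B) (leg (tag x)).
  move=> [u|] [v|] /and3P[uB vB]; rewrite ?(negPf ncB) // in uB vB *.
  by case/andP=> /eqP uv _; rewrite !inE uv.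
have /forall_inP/(_ y yB) xy := conB _ xB.
by rewrite -(closed_connect closed_leg xy) inE.
Qed.

(** Blocks too large to fit in any leg but the [i0]-th force everything outside
    leg [i0] into the block of the centre. *)
Lemma centre_block_large {lam} {i0 : 'I_(size lam)} {P : {set {set spider lam}}} :
  connected_partition (spider_adj lam) P ->
  (forall B (i : 'I_(size lam)), B \in P -> i != i0 -> nth 0 lam i < #|B|) ->
  #|spider lam| <= #|pblock P None| + nth 0 lam i0.
Proof.
move=> /andP[partP /forall_inP conP] large.
have /and3P[/eqP covP trivP _] := partP.
have in_cov v : v \in cover P by rewrite covP inE.
rewrite -(cardsC (pblock P None)) leq_add2l.
apply: leq_trans (card_leg i0); apply/subset_leq_card/subsetP => -[x|].
  2: by rewrite inE mem_pblock in_cov.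
rewrite inE => xP; rewrite inE; apply: contraT => xi0.
have BP := pblock_mem (in_cov (Some x)).
have ncB : None \notin pblock P (Some x).
  by apply: contra xP => /(same_pblock trivP) ->; rewrite mem_pblock in_cov.
have xB : Some x \in pblock P (Some x) by rewrite mem_pblock in_cov.
have := subset_leq_card (centreless_block_in_leg (conP _ BP) ncB xB).
by move=> /leq_trans/(_ (card_leg _)); rewrite leqNgt large.
Qed.

Lemma int_partition_nth_le {lam i j} :
  is_int_partition lam -> i <= j -> j < size lam -> nth 0 lam j <= nth 0 lam i.
Proof.
move=> /andP[slam _] ij jlt.
have geq_trans : transitive geq by move=> a b c ba ac; apply: leq_trans ac ba.
by apply: (sorted_leq_nth geq_trans leqnn 0 slam); rewrite ?inE //; lia.
Qed.

(** With [l] standing for [lambda_2], the left-hand side of the conclusion is the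
    largest part of the type.  The bounds on [l], [q * (l + 1) + r] and [r] force
    [q >= 3], hence [3 * d + r' <= l]. *)
Lemma largest_part_le_double {q l d r r'} :
  2 <= l -> 4 * l + 1 <= q * (l + 1) + r -> r <= l -> r = q * d + r' ->
  l + d + 1 + (0 < r') <= 2 * l.
Proof.
move=> l_ge2 n_large r_le def_r.
have q_ge3 : 3 <= q.
  rewrite ltnNge; apply/negP => q_le2.
  have : q * (l + 1) <= 2 * (l + 1) by rewrite leq_mul2r q_le2 orbT.
  lia.
have : 3 * d <= q * d by rewrite leq_mul2r q_ge3 orbT.
by case: r' def_r => [|r'] /=; lia.
Qed.

Theorem lemma26 (lam : seq nat) (n q r d' r' : nat)
  (hlam : is_int_partition lam)
  (hd : 3 <= size lam)
  (hn : #|spider lam| = n)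
  (h1 : nth 0 lam 0 >= \sum_(1 <= i < size lam) nth 0 lam i)
  (h2 : nth 0 lam 1 <= \sum_(2 <= i < size lam) nth 0 lam i)
  (h2ge2 : 2 <= nth 0 lam 1)
  (hqr : n = q * (nth 0 lam 1 + 1) + r)
  (hr : r < nth 0 lam 1 + 1)
  (hdr : r = q * d' + r')
  (hr' : r' < q)
  (hcase : 3 <= nth 0 lam 1 \/ (nth 0 lam 1 = 2 /\ 3 <= q)) :
  missing_connected_partition (spider_adj lam)
    (nseq r' (nth 0 lam 1 + d' + 2) ++ nseq (q - r') (nth 0 lam 1 + d' + 1)).
Proof.
set l1 := nth 0 lam 1 in h1 h2 h2ge2 hqr hr hcase *.
case=> P [conP typP].
have part_size B : B \in P -> l1 < #|B| <= l1 + d' + 1 + (0 < r').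
  move=> BP; have : #|B| \in partition_type P.
    by rewrite mem_sort map_f // mem_enum.
  rewrite typP mem_cat !mem_nseq.
  by case/orP=> /andP[r'_gt0 /eqP->]; rewrite ?r'_gt0; lia.
have size_gt0 : 0 < size lam by lia.
have large B (i : 'I_(size lam)) :
    B \in P -> i != Ordinal size_gt0 -> nth 0 lam i < #|B|.
  move=> /part_size/andP[sB _]; rewrite -val_eqE /= -lt0n => i_gt0.
  exact: leq_ltn_trans (int_partition_nth_le hlam i_gt0 (ltn_ord i)) sB.
have centre_part : pblock P None \in P.
  by apply: pblock_mem; case/andP: conP => /and3P[/eqP-> _ _] _; rewrite inE.
have /andP[_ centre_le] := part_size _ centre_part.
have centre_ge := leq_trans (centre_block_large conP large)
                            (leq_add centre_le (leqnn _)).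
have sum_lam : sumn lam = nth 0 lam 0 + \sum_(1 <= i < size lam) nth 0 lam i.
  by rewrite sumnE (big_nth 0) big_ltn.
have sum_tail : \sum_(1 <= i < size lam) nth 0 lam i =
    l1 + \sum_(2 <= i < size lam) nth 0 lam i by rewrite big_ltn //; lia.
rewrite /= card_spider sum_lam sum_tail in hn centre_ge h1.
move: (\sum_(2 <= i < size lam) _) (nth 0 lam 0) => T l0 in h1 h2 hn centre_ge.
have n_large : 4 * l1 + 1 <= q * (l1 + 1) + r by rewrite -hqr -hn; lia.
have r_le : r <= l1 by move: hr; rewrite addn1 ltnS.
have := largest_part_le_double h2ge2 n_large r_le hdr.
lia.
Qed.
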